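(* Let $W(x)=\sum_{n\ge1}w_nx^n$, where $w_n$ is the number of block-wise simple permutations in $\mathcal{S}_n$, and let $F(x)=\sum_{n\ge1}n!\,x^n$. Let $W^{-1}$ and $F^{-1}$ be the compositional inverses of $W$ and $F$ as formal power series. Then, as formal power series, $$W^{-1}(t)=F^{-1}(t)+\frac{2t^2}{1+t}.$$
   Context: $\mathcal{S}_n$ is the set of permutations of $\{1,\dots,n\}$, written in one-line notation. An interval of $\pi=a_1\cdots a_n\in\mathcal{S}_n$ is a non-empty contiguous sequence of entries $a_ia_{i+1}\cdots a_{i+k}$ whose values form a set of consecutive integers. The whole permutation and the single entries are the trivial intervals; all others are proper. A permutation is simple if it has no proper intervals. Inflation: for $\sigma\in\mathcal{S}_k$ and $\alpha_i\in\mathcal{S}_{n_i}$ ($n_i\ge1$, $1\le i\le k$), $\sigma[\alpha_1,\dots,\alpha_k]\in\mathcal{S}_{n_1+\cdots+n_k}$ is the permutation obtained by replacing the $i$-th entry of $\sigma$, for each $i$, by a block of $n_i$ consecutive positions and consecutive values that is order-isomorphic to $\alpha_i$, the blocks being in the same relative order (in values) as the entries of $\sigma$. Example: $2413[213,21,132,1]=546\,98\,132\,7$. Block-wise simple permutations are defined recursively: (1) the permutation $1\in\mathcal{S}_1$ is block-wise simple; (2) $\pi\in\mathcal{S}_n$ is block-wise simple if there are a simple permutation $\sigma\in\mathcal{S}_k$ with $k\ge 4$ and block-wise simple permutations $\alpha_1,\dots,\alpha_k$ such that $\pi=\sigma[\alpha_1,\dots,\alpha_k]$. No other permutations are block-wise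 simple (so $w_1=1$, $w_2=w_3=0$). *)

(* Defs.v *)
From HB Require Import structures.
From mathcomp Require Import all_boot all_order all_fingroup all_algebra.
From mathcomp Require Import boolp classical_sets.

Set Implicit Arguments.
Unset Strict Implicit.
Unset Printing Implicit Defensive.

Import GRing.Theory.

(* A permutation of {1, ..., n} in one-line notation is encoded as p : 'S_n,
   a permutation of {0, ..., n - 1}, read as p 0, p 1, ..., p (n - 1):
   positions and values are both shifted down by 1. *)

Section Intervals.
Context (n : nat) (p : 'S_n).

(* i and j are the first and last positions (not values) of the interval;
   every set of consecutive integers in play is some {a, ..., b} *)
Definition is_interval (i j : 'I_n) : bool :=
  (i <= j) &&
  [exists a : 'I_n, exists b : 'I_n,
    [set p l | l : 'I_n & i <= l <= j] == [set v : 'I_n | a <= v <= b]].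

Definition trivial_interval (i j : 'I_n) : bool :=
  (i == j) || ((i == 0 :> nat) && (j.+1 == n)).

Definition simple_perm : bool :=
  [forall i : 'I_n, forall j : 'I_n,
    is_interval i j ==> trivial_interval i j].

End Intervals.

(* [tagnat.sig1 x] is the block containing the position x, and
   [tagnat.sig2 x] the rank of x inside that block: by [tagnat.rankEsum],
   the position of rank j in block i is \sum_(i' < k | i' < i) m i' + j. *)
Section Inflation.
Context (k : nat) (s : 'S_k) (m : 'I_k -> nat) (a : forall i, 'S_(m i)).

Definition infl_val (x : 'I_(\sum_i m i)) : nat :=
  \sum_(i < k | s i < s (tagnat.sig1 x)) m i
    + a (tagnat.sig1 x) (tagnat.sig2 x).

Lemma infl_val_lt_next x (i : 'I_k) :
  s (tagnat.sig1 x) < s i -> infl_val x < \sum_(i' < k | s i' < s i) m i'.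
Proof.
move=> lt_i; rewrite /infl_val.
rewrite [X in _ < X](bigID (fun i' => s i' < s (tagnat.sig1 x))) /=.
have -> : \sum_(i' < k | (s i' < s i) && (s i' < s (tagnat.sig1 x))) m i'
        = \sum_(i' < k | s i' < s (tagnat.sig1 x)) m i'.
  apply: eq_bigl => i'; apply: andb_idl => lt_i'; exact: ltn_trans lt_i' lt_i.
by rewrite ltn_add2l (bigD1 (tagnat.sig1 x)) /= ?ltnn ?lt_i // ltn_addr.
Qed.

Lemma infl_val_lt x : infl_val x < \sum_i m i.
Proof.
rewrite /infl_val.
rewrite [X in _ < X](bigID (fun i' => s i' < s (tagnat.sig1 x))) /=.
by rewrite ltn_add2l (bigD1 (tagnat.sig1 x)) /= ?ltnn // ltn_addr.
Qed.

Lemma infl_val_inj : injective (fun x => Ordinal (infl_val_lt x)).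
Proof.
move=> x y /(congr1 val) /= exy.
have e1 : tagnat.sig1 x = tagnat.sig1 y.
  apply: (@perm_inj _ s); apply: val_inj => /=.
  case: (ltngtP (s (tagnat.sig1 x)) (s (tagnat.sig1 y))) => // lt_xy.
    have := infl_val_lt_next lt_xy.
    by rewrite exy /infl_val ltnNge leq_addr.
  have := infl_val_lt_next lt_xy.
  by rewrite -exy /infl_val ltnNge leq_addr.
rewrite -(tagnat.sig2K x) -(tagnat.sig2K y).
move: exy; rewrite /infl_val.
case: _ / e1 (tagnat.sig2 y) => j.
by move=> /addnI /val_inj /perm_inj ->.
Qed.

Definition inflation : 'S_(\sum_i m i) := perm infl_val_inj.

Lemma inflationE x : inflation x = infl_val x :> nat.
Proof. by rewrite permE. Qed.

End Inflation.

Inductive blockwise_simple : forall n : nat, 'S_n -> Prop :=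
| blockwise_simple_one (p : 'S_1) : blockwise_simple p
| blockwise_simple_infl (k : nat) (s : 'S_k) (m : 'I_k -> nat)
    (a : forall i, 'S_(m i)) :
    4 <= k -> simple_perm s -> (forall i, blockwise_simple (a i)) ->
    blockwise_simple (inflation s a).

Definition num_blockwise_simple (n : nat) : nat :=
  #|[pred p : 'S_n | `[< blockwise_simple p >]]|.

Local Open Scope ring_scope.

(* [f n] is the coefficient of f in degree n *)
Record fps (R : Type) := Fps { fps_coef :> nat -> R }.

Notation "{ 'fps' R }" := (fps R) (format "{ 'fps'  R }") : type_scope.

HB.instance Definition _ (R : Type) := gen_eqMixin {fps R}.
HB.instance Definition _ (R : Type) := gen_choiceMixin {fps R}.

Lemma fpsP (R : Type) (f g : {fps R}) : (forall n, f n = g n) <-> f = g.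
Proof.
split=> [|-> //]; case: f g => [f] [g] /= fg; congr Fps; exact/funext.
Qed.

Section Zmodule.
Context (R : zmodType).
Implicit Types f g h : {fps R}.

Definition fps_zero : {fps R} := Fps (fun=> 0).
Definition fps_add f g : {fps R} := Fps (fun n => f n + g n).
Definition fps_opp f : {fps R} := Fps (fun n => - f n).

Lemma fps_addA : associative fps_add.
Proof. by move=> f g h; apply/fpsP => n; exact: addrA. Qed.
Lemma fps_addC : commutative fps_add.
Proof. by move=> f g; apply/fpsP => n; exact: addrC. Qed.
Lemma fps_add0 : left_id fps_zero fps_add.
Proof. by move=> f; apply/fpsP => n; exact: add0r. Qed.
Lemma fps_addN : left_inverse fps_zero fps_opp fps_add.
Proof. by move=> f; apply/fpsP => n; exact: addNr. Qed.

HB.instance Definition _ :=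
  GRing.isZmodule.Build {fps R} fps_addA fps_addC fps_add0 fps_addN.

Lemma fps_coef0 n : (0 : {fps R}) n = 0. Proof. by []. Qed.
Lemma fps_coefD f g n : (f + g) n = f n + g n. Proof. by []. Qed.
Lemma fps_coefN f n : (- f) n = - f n. Proof. by []. Qed.

End Zmodule.

Section Ring.
Context (R : comNzRingType).
Implicit Types f g h : {fps R}.

Definition fps_one : {fps R} := Fps (fun n => (n == 0%N)%:R).
Definition fps_mul f g : {fps R} :=
  Fps (fun n => \sum_(i < n.+1) f i * g (n - i)%N).

Definition fps_trunc (n : nat) f : {poly R} := \poly_(i < n) f i.

Lemma coef_fps_trunc n f i : (i < n)%N -> (fps_trunc n f)`_i = f i.
Proof. by move=> lt_in; rewrite coef_poly lt_in. Qed.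

Lemma fps_mul_trunc n f g i : (i < n)%N ->
  fps_mul f g i = (fps_trunc n f * fps_trunc n g)`_i.
Proof.
move=> lt_in; rewrite coefM; apply: eq_bigr => j _.
rewrite !coef_fps_trunc //; first exact: leq_ltn_trans (leq_subr _ _) lt_in.
by apply: leq_ltn_trans lt_in; rewrite -ltnS.
Qed.

Lemma fps_mulC : commutative fps_mul.
Proof.
by move=> f g; apply/fpsP => n; rewrite !(fps_mul_trunc (n := n.+1)) // mulrC.
Qed.

Lemma fps_mul1 : left_id fps_one fps_mul.
Proof.
move=> f; apply/fpsP => n /=; rewrite big_ord_recl /= mul1r subn0.
by rewrite big1 ?addr0 // => i _; rewrite mul0r.
Qed.

Lemma fps_mulD : left_distributive fps_mul (@fps_add R).
Proof.
move=> f g h; apply/fpsP => n /=; rewrite -big_split /=.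
by apply: eq_bigr => i _; rewrite mulrDl.
Qed.

Lemma coefM_modl (p q r : {poly R}) i :
  (forall j, (j <= i)%N -> p`_j = q`_j) -> (p * r)`_i = (q * r)`_i.
Proof.
by move=> pq; rewrite !coefM; apply: eq_bigr => j _; rewrite pq // -ltnS.
Qed.

Lemma fps_mulA : associative fps_mul.
Proof.
move=> f g h; apply/fpsP => n; rewrite !(fps_mul_trunc (n := n.+1)) //.
rewrite mulrC; pose T := fps_trunc n.+1.
transitivity ((T g * T h * T f)`_n).
  by apply: coefM_modl => j le_jn; rewrite coef_fps_trunc // (fps_mul_trunc (n := n.+1)).
rewrite mulrC mulrA; apply: coefM_modl => j le_jn.
by rewrite coef_fps_trunc // -fps_mul_trunc.
Qed.

Lemma fps_one_neq0 : fps_one != 0.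
Proof. by apply/eqP => /fpsP /(_ 0%N) /eqP; rewrite oner_eq0. Qed.

HB.instance Definition _ := GRing.Zmodule_isComNzRing.Build {fps R}
  fps_mulA fps_mulC fps_mul1 fps_mulD fps_one_neq0.

Lemma fps_coef1 n : (1 : {fps R}) n = (n == 0%N)%:R. Proof. by []. Qed.
Lemma fps_coefM f g n : (f * g) n = \sum_(i < n.+1) f i * g (n - i)%N.
Proof. by []. Qed.

Definition fps_unit : {pred {fps R}} := fun f => `[< exists g, g * f = 1 >].
Definition fps_inv f : {fps R} := xget f (fun g => g * f = 1).

Lemma fps_mulV : {in fps_unit, left_inverse 1 fps_inv *%R}.
Proof.
move=> f /asboolP [g gf1]; rewrite /fps_inv.
by case: xgetP => [h _ //|/(_ g)].
Qed.
Lemma fps_unitP f g : g * f = 1 -> fps_unit f.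
Proof. by move=> gf1; apply/asboolP; exists g. Qed.
Lemma fps_inv_out : {in [predC fps_unit], fps_inv =1 id}.
Proof.
move=> f; rewrite inE /= => /asboolPn nf; rewrite /fps_inv.
by case: xgetP => // g _ gf1; case: nf; exists g.
Qed.

HB.instance Definition _ := GRing.ComNzRing_hasMulInverse.Build {fps R}
  fps_mulV fps_unitP fps_inv_out.

Definition fpsX : {fps R} := Fps (fun n => (n == 1%N)%:R).

(* f(g(x)); as g has no constant term in every use below, only the powers
   g^k with k <= n contribute in degree n *)
Definition fps_comp f g : {fps R} :=
  Fps (fun n => \sum_(k < n.+1) f k * (g ^+ k) n).

Definition is_compinv f g : Prop :=
  [/\ f 0%N = 0, g 0%N = 0, fps_comp f g = fpsX & fps_comp g f = fpsX].

(* existence and uniqueness of the inverse: [compinvP], [is_compinv_uniq];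
   the default value 0 is never met for [W_series] and [F_series] *)
Definition compinv f : {fps R} := xget 0 (is_compinv f).

Lemma fps_coefX_trunc n f k i : (i < n)%N ->
  (f ^+ k) i = (fps_trunc n f ^+ k)`_i.
Proof.
elim: k i => [|k IHk] i lt_in; first by rewrite !expr0 coef1.
rewrite !exprS fps_coefM coefM; apply: eq_bigr => j _.
rewrite IHk ?coef_fps_trunc //; last exact: leq_ltn_trans (leq_subr _ _) lt_in.
by apply: leq_ltn_trans lt_in; rewrite -ltnS.
Qed.

Lemma coefX_val (p : {poly R}) k i : p`_0 = 0 -> (i < k)%N -> (p ^+ k)`_i = 0.
Proof.
move=> p0; elim: k i => // k IHk i lt_ik; rewrite exprS coefM big1 // => j _.
case: (posnP j) => [->|j_gt0]; first by rewrite p0 mul0r.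
rewrite IHk ?mulr0 // ltn_subLR; last by rewrite -ltnS.
by apply: leq_trans lt_ik _; rewrite -add1n leq_add2r.
Qed.

Lemma fps_coefX_val f k i : f 0%N = 0 -> (i < k)%N -> (f ^+ k) i = 0.
Proof.
move=> f0 lt_ik; rewrite (fps_coefX_trunc _ _ (ltnSn i)) coefX_val //.
by rewrite coef_fps_trunc.
Qed.

Lemma fps_coefX_diag f k : f 0%N = 0 -> (f ^+ k) k = f 1%N ^+ k.
Proof.
move=> f0; elim: k => [|k IHk]; first by rewrite !expr0.
rewrite exprS fps_coefM big_ord_recl f0 mul0r add0r big_ord_recl /=.
rewrite /bump /= subSS subn0 IHk exprS big1 ?addr0 // => i _.
by rewrite fps_coefX_val ?mulr0 //= /bump /= subSS ltn_subrL; case: k i {IHk} => [[]|].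
Qed.

Lemma coef_comp_poly_val (p q : {poly R}) n : q`_0 = 0 ->
  (p \Po q)`_n = \sum_(k < n.+1) p`_k * (q ^+ k)`_n.
Proof.
move=> q0; rewrite coef_comp_poly.
pose G k := p`_k * (q ^+ k)`_n; set N := maxn n.+1 (size p).
rewrite (big_ord_widen N G) ?leq_maxr // (big_ord_widen N G) ?leq_maxl //.
rewrite big_mkcond [RHS]big_mkcond; apply: eq_bigr => i _ /=.
rewrite ltnS /G; case: ltnP => [_|le_pi]; case: leqP => // lt_ni.
  by rewrite coefX_val ?mulr0.
by rewrite nth_default ?mul0r.
Qed.

Lemma fps_comp_trunc f g n i : g 0%N = 0 -> (i < n)%N ->
  fps_comp f g i = (fps_trunc n f \Po fps_trunc n g)`_i.
Proof.
move=> g0 lt_in; rewrite coef_comp_poly_val; last first.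
  by rewrite coef_fps_trunc //; apply: leq_ltn_trans lt_in.
apply: eq_bigr => k _; rewrite (fps_coefX_trunc _ _ lt_in) coef_fps_trunc //.
by apply: leq_ltn_trans lt_in; rewrite -ltnS.
Qed.

Lemma fps_comp_coef0 f g : fps_comp f g 0%N = f 0%N.
Proof. by rewrite /= big_ord1 expr0 mulr1. Qed.

Lemma fps_compM f g h : h 0%N = 0 ->
  fps_comp (f * g) h = fps_comp f h * fps_comp g h.
Proof.
move=> h0; apply/fpsP => n; pose T := fps_trunc n.+1.
have -> : fps_comp (f * g) h n = ((T f * T g) \Po T h)`_n.
  rewrite coef_comp_poly_val ?coef_fps_trunc //; apply: eq_bigr => k _.
  by rewrite -fps_mul_trunc // (fps_coefX_trunc _ _ (ltnSn n)).
rewrite rmorphM coefM; apply: eq_bigr => i _.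
by rewrite -!fps_comp_trunc // ltnS leq_subr.
Qed.

Lemma fps_comp1 h : fps_comp 1 h = 1.
Proof.
apply/fpsP => n; rewrite /= big_ord_recl big1 ?addr0 ?mul1r ?expr0 // => i _.
by rewrite mul0r.
Qed.

Lemma fps_compX f h k : h 0%N = 0 -> fps_comp (f ^+ k) h = fps_comp f h ^+ k.
Proof.
move=> h0; elim: k => [|k IHk]; first by rewrite !expr0 fps_comp1.
by rewrite !exprS fps_compM // IHk.
Qed.

Lemma fps_compA f g h : g 0%N = 0 -> h 0%N = 0 ->
  fps_comp f (fps_comp g h) = fps_comp (fps_comp f g) h.
Proof.
move=> g0 h0; apply/fpsP => n /=.
under eq_bigr => j _ do rewrite -fps_compX // mulr_sumr.
rewrite exchange_big /=; apply: eq_bigr => k _.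
pose G j := f j * (g ^+ j) k.
transitivity ((\sum_(j < n.+1) G j) * (h ^+ k) n).
  by rewrite mulr_suml; apply: eq_bigr => j _; rewrite mulrA.
congr (_ * _); rewrite [RHS](big_ord_widen n.+1 G) // [RHS]big_mkcond.
apply: eq_bigr => j _ /=; rewrite ltnS; case: leqP => // lt_kj.
by rewrite /G fps_coefX_val ?mulr0.
Qed.

Lemma fpsX_exp k n : (fpsX ^+ k) n = (n == k)%:R.
Proof.
elim: k n => [|k IHk] n; first by rewrite expr0.
rewrite exprS fps_coefM; case: n => [|n].
  by rewrite big_ord1 /= mul0r.
rewrite big_ord_recl /= mul0r add0r big_ord_recl /= mul1r subSS subn0 IHk eqSS.
by rewrite big1 ?addr0 // => i _; rewrite mul0r.
Qed.

Lemma fps_compfX f : fps_comp f fpsX = f.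
Proof.
apply/fpsP => n /=; rewrite big_ord_recr /= fpsX_exp eqxx mulr1 big1 ?add0r //.
by move=> i _; rewrite fpsX_exp gtn_eqF ?mulr0 //.
Qed.

Lemma fps_compXf f : f 0%N = 0 -> fps_comp fpsX f = f.
Proof.
move=> f0; apply/fpsP => -[|n] /=; first by rewrite big_ord1 mul0r f0.
rewrite big_ord_recl mul0r add0r big_ord_recl mul1r expr1.
by rewrite big1 ?addr0 // => i _; rewrite mul0r.
Qed.

Lemma is_compinv_uniq f g g' : is_compinv f g -> is_compinv f g' -> g = g'.
Proof.
move=> [f0 g0 _ gf] [_ g'0 fg' _].
by rewrite -[g]fps_compfX -fg' fps_compA // gf fps_compXf.
Qed.

Lemma fps_rec (Phi : nat -> {fps R} -> R) :
  (forall n g g', (forall k, (k < n)%N -> g k = g' k) -> Phi n g = Phi n g') ->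
  exists g, forall n, g n = Phi n g.
Proof.
move=> PhiP.
pose step n g : {fps R} := Fps (fun k => if k == n then Phi n g else g k).
pose fix G n := if n is m.+1 then step m (G m) else 0.
have GE n m : (n <= m)%N -> forall k, (k < n)%N -> G m k = G n k.
  elim: m => [|m IHm]; first by rewrite leqn0 => /eqP ->.
  rewrite leq_eqVlt => /predU1P [-> //|lt_nm k lt_kn] /=.
  by rewrite ltn_eqF ?IHm // (leq_trans lt_kn).
exists (Fps (fun n => G n.+1 n)) => n /=; rewrite eqxx.
by apply: PhiP => k lt_kn; rewrite (GE k.+1 n).
Qed.

End Ring.

Section CompInverse.
Context (R : comUnitRingType).
Implicit Types f g : {fps R}.

Lemma fps_unitE f : f 0%N \is a GRing.unit -> f \is a GRing.unit.
Proof.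
move=> uf; apply/unitrPr.
pose Phi n (g : {fps R}) :=
  (f 0%N)^-1 * ((1 : {fps R}) n - \sum_(i < n) f i.+1 * g (n - i.+1)%N).
have [n g g' eq_g|g gE] := @fps_rec _ Phi.
  congr (_ * (_ - _)); apply: eq_bigr => i _; rewrite eq_g // ltn_subrL /=.
  exact: leq_ltn_trans (ltn_ord i).
exists g; apply/fpsP => n; rewrite fps_coefM big_ord_recl subn0 gE mulVKr //.
by rewrite subrK.
Qed.

Lemma fps_comp_left_inverse f : f 0%N = 0 -> f 1%N \is a GRing.unit ->
  exists g, [/\ g 0%N = 0, g 1%N \is a GRing.unit & fps_comp g f = fpsX R].
Proof.
move=> f0 uf1.
pose Phi n (g : {fps R}) :=
  (f 1%N ^+ n)^-1 * (fpsX R n - \sum_(k < n) g k * (f ^+ k) n).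
have [n g g' eq_g|g gE] := @fps_rec _ Phi.
  by congr (_ * (_ - _)); apply: eq_bigr => i _; rewrite eq_g.
have gf : fps_comp g f = fpsX R.
  apply/fpsP => n; rewrite /= big_ord_recr /= fps_coefX_diag // gE /Phi.
  by rewrite mulrC mulVKr ?unitrX // addrC subrK.
have g0 : g 0%N = 0 by rewrite gE /Phi /= big_ord0 subr0 mulr0.
exists g; split=> //; rewrite gE /Phi /= big_ord1 g0 mul0r subr0 mulr1.
by rewrite unitrV unitrX.
Qed.

Lemma compinvP f : f 0%N = 0 -> f 1%N \is a GRing.unit ->
  is_compinv f (compinv f).
Proof.
move=> f0 /(fps_comp_left_inverse f0) [g [g0 ug gf]].
have [h [h0 _ hg]] := fps_comp_left_inverse g0 ug.
have fg : fps_comp f g = fpsX R.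
  suff -> : f = h by [].
  by rewrite -[f]fps_compXf // -hg -fps_compA // gf fps_compfX.
by rewrite /compinv; case: xgetP => [k -> //|/(_ g)] => /(_ _)[].
Qed.

End CompInverse.

Definition W_series : {fps rat} :=
  Fps (fun n => if n is 0 then 0 else (num_blockwise_simple n)%:R).

Definition F_series : {fps rat} :=
  Fps (fun n => if n is 0 then 0 else (n`!)%:R).

Lemma num_blockwise_simple1 : num_blockwise_simple 1 = 1%N.
Proof.
rewrite /num_blockwise_simple (@eq_card _ _ predT) ?card_Sn // => p.
by rewrite !inE; apply/asboolP; exact: blockwise_simple_one.
Qed.

Lemma W_compinvP : is_compinv W_series (compinv W_series).
Proof. by apply: compinvP; rewrite //= num_blockwise_simple1 unitr1. Qed.

Lemma F_compinvP : is_compinv F_series (compinv F_series).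
Proof. by apply: compinvP; rewrite //= unitr1. Qed.

Lemma fps_unit_1DX : (1 + fpsX rat : {fps rat}) \is a GRing.unit.
Proof. by apply: fps_unitE; rewrite fps_coefD /= addr0 unitr1. Qed.

(* Main.v *)
Require Import Defs.
From mathcomp Require Import all_boot all_order all_fingroup all_algebra.
From mathcomp Require Import boolp zify ring.

(* Substitution decomposition: a permutation of length > 1 is either of the
   form 12[a, b] with a sum-indecomposable, or the reverse of such a
   permutation, or s[a_1, ..., a_k] for a simple s of length k >= 4, in exactly
   one of these ways and with unique s and a_i. Hence, with S the series of the
   simple permutations of length >= 4,
     F = x + S(F) + 2 F^2 / (1 + F)   and   W = x + S(W),
   and substituting F^-1, resp. W^-1, and eliminating S gives the theorem.

   The decomposition exists because the quotient of p by a coarsest partition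
   into at least two intervals is simple; it is unique because the blocks of a
   simple inflation contain every proper interval. *)

Set Implicit Arguments.
Unset Strict Implicit.
Unset Printing Implicit Defensive.

Import GRing.Theory.

(** * Permutations recovered from the relative order of their entries *)

Lemma widen_ord_inj v n (le_vn : v <= n) : injective (widen_ord le_vn).
Proof. by move=> x y /(congr1 val) /= /val_inj. Qed.

Lemma card_lt_ord n v : v <= n -> #|[set w : 'I_n | w < v]| = v.
Proof.
move=> le_vn; rewrite -[RHS]card_ord -(card_imset _ (@widen_ord_inj _ _ le_vn)).
apply: eq_card => w; rewrite inE; apply/idP/imsetP => [lt_wv|[u _ ->]] /=.
  by exists (Ordinal lt_wv) => //; apply: val_inj.
exact: ltn_ord.
Qed.

Lemma perm_val_card n (p : 'S_n) x : p x = #|[set y | p y < p x]| :> nat.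
Proof.
rewrite -{1}(@card_lt_ord n (p x)) 1?ltnW // -(card_imset _ (@perm_inj _ p)).
apply: eq_card => w; rewrite inE; apply/idP/imsetP => [lt_w|[u]].
  by exists (p^-1%g w); rewrite ?inE permKV.
by rewrite inE => lt_u ->.
Qed.

Lemma perm_eq_lt n (p q : 'S_n) :
  (forall x y, (p x < p y) = (q x < q y)) -> p = q.
Proof.
move=> pq; apply/permP => x; apply: val_inj.
rewrite /= (perm_val_card p) (perm_val_card q).
by apply: eq_card => y; rewrite !inE pq.
Qed.

(** [s x] is the rank of [f x], the number of smaller values of [f]. *)
Lemma perm_standardize n (f : 'I_n -> nat) : injective f ->
  exists s : 'S_n, forall x y, (s x < s y) = (f x < f y).
Proof.
move=> f_inj; pose r x := #|[set y | f y < f x]|.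
have r_lt x : r x < n.
  rewrite -[X in _ < X]card_ord -cardsT; apply: proper_card.
  by rewrite properT; apply/eqP => /setP /(_ x); rewrite !inE ltnn.
have rE x y : (r x < r y) = (f x < f y).
  have r_homo u v : f u <= f v -> r u <= r v.
    move=> le_uv; apply: subset_leq_card; apply/subsetP => w; rewrite !inE => lt_w.
    exact: leq_trans le_uv.
  case: (ltnP (f x) (f y)) => [lt_xy|/r_homo]; last by case: ltnP.
  apply: proper_card; apply/properP; split.
    by apply/subsetP => w; rewrite !inE => /ltn_trans ->.
  by exists x; rewrite !inE ?ltnn.
have r_inj : injective (fun x => Ordinal (r_lt x)).
  move=> x y /(congr1 val) /= rxy; apply: f_inj.
  by have := rE x y; have := rE y x; rewrite rxy ltnn; case: ltngtP.
by exists (perm r_inj) => x y; rewrite !permE rE.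
Qed.

Lemma perm_lt_negb n (p : 'S_n) x y : x != y -> (p x < p y) = ~~ (p y < p x).
Proof.
move=> neq_xy; rewrite -leqNgt ltn_neqAle.
by have -> : p x != p y :> nat by rewrite (inj_eq val_inj) (inj_eq perm_inj).
Qed.

(** * Intervals as modules of two orders *)

(* A is a module of the order [fun x y => p x < p y]; an interval of p is a
   module both for p and for the natural order, which is that of [1%g]. *)
Definition order_module n (p : 'S_n) (A : {set 'I_n}) :=
  forall x y z, x \in A -> y \in A -> z \notin A -> (p z < p x) = (p z < p y).

Lemma order_module_convex n (p : 'S_n) A x y z : order_module p A ->
  x \in A -> y \in A -> p x <= p z <= p y -> z \in A.
Proof.
move=> modA xA yA /andP[le_xz le_zy]; case: (boolP (z \in A)) => // zA.
have := modA _ _ _ xA yA zA.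
have -> : p z < p x = false by rewrite ltnNge le_xz.
have -> // : p z < p y.
rewrite ltn_neqAle le_zy andbT (inj_eq val_inj) (inj_eq perm_inj).
by apply: contraNneq zA => ->.
Qed.

(** The new case is z in B: as B is a module, z compares with x and y as u does, and u lies outside
    A. *)
Lemma order_moduleD n (p : 'S_n) A B u : order_module p A -> order_module p B ->
  u \in B -> u \notin A -> order_module p (A :\: B).
Proof.
move=> modA modB uB uA x y z; rewrite !inE negb_and negbK.
move=> /andP[xB xA] /andP[yB yA] /orP[zB|zA]; last exact: modA.
have neq w : w \notin B -> forall v, v \in B -> v != w.
  by move=> wB v vB; apply: contraNneq wB => <-.
rewrite (perm_lt_negb p (neq x xB z zB)) (perm_lt_negb p (neq y yB z zB)).
rewrite (modB z u x) // (modB z u y) //.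
rewrite -(perm_lt_negb p (neq x xB u uB)) -(perm_lt_negb p (neq y yB u uB)).
exact: modA.
Qed.

(** Modules are convex, so A is cut out by its extreme points in both orders: an interval of
    positions mapped onto an interval of values. The second alternative covers the empty set and the
    singletons. *)
Lemma simple_perm_module n (s : 'S_n) A : simple_perm s ->
  order_module 1%g A -> order_module s A ->
  A = setT \/ {in A &, forall x y, x = y}.
Proof.
move=> /forallP s_simple mod1 mods.
case: (set_0Vmem A) => [->|[x0 x0A]]; first by right=> x; rewrite inE.
case: (arg_minnP val x0A) => i iA i_min; case: (arg_maxnP val x0A) => j jA j_max.
case: (arg_minnP (fun x => s x) x0A) => a aA a_min.
case: (arg_maxnP (fun x => s x) x0A) => b bA b_max.
have AE l : (l \in A) = (i <= l <= j).
  apply/idP/idP => [lA|]; first by apply/andP; split; [exact: i_min|exact: j_max].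
  by move=> ij; apply: (order_module_convex mod1 iA jA); rewrite !perm1.
have /implyP := forallP (s_simple i) j; rewrite /is_interval /trivial_interval.
have -> /= : i <= j by exact: i_min.
case/(_ _)/orP => [|/eqP eq_ij|/andP[/eqP i0 /eqP jn]].
- apply/existsP; exists (s a); apply/existsP; exists (s b); apply/eqP/setP => v.
  rewrite inE; apply/imsetP/idP => [[l]|ab].
    by rewrite inE -AE => lA ->; apply/andP; split; [exact: a_min|exact: b_max].
  exists (s^-1%g v); rewrite ?permKV // inE -AE.
  by apply: (order_module_convex mods aA bA); rewrite !permKV.
- right=> x y; rewrite !AE eq_ij -!eqn_leq => /eqP jx /eqP jy.
  by apply: val_inj; rewrite /= -jx -jy.
- by left; apply/setP => l; rewrite inE AE i0 /=; have := ltn_ord l; lia.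
Qed.

Lemma nonsimple_perm_module n (s : 'S_n) : ~~ simple_perm s ->
  exists i j : 'I_n, [/\ i < j, (0 < i) || (j.+1 < n)
    & order_module s [set l : 'I_n | i <= l <= j]].
Proof.
rewrite negb_forall => /existsP[i]; rewrite negb_forall => /existsP[j].
rewrite negb_imply /is_interval /trivial_interval.
case/andP=> /andP[le_ij /existsP[a /existsP[b /eqP /setP sE]]].
rewrite negb_or negb_and => /andP[neq_ij ij_proper]; exists i, j; split.
- by rewrite ltn_neqAle neq_ij.
- by have := ltn_ord j; move: ij_proper; lia.
have {}sE (l : 'I_n) : (i <= l <= j) = (a <= s l <= b).
  have := sE (s l); rewrite inE => <-; rewrite mem_imset ?inE //.
  exact: perm_inj.
by move=> x y z; rewrite !inE !sE; lia.
Qed.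

(** * Quotients by a partition into blocks *)

Section Quotient.
Context (n k : nat) (b : 'I_n -> 'I_k).

(** [b] maps a position to its block. With [p] and [s] both [1%g] the condition says that [b] is
    nondecreasing, that is, that blocks are runs of consecutive positions. *)
Definition order_quotient (p : 'S_n) (s : 'S_k) :=
  forall x y, b x != b y -> (p x < p y) = (s (b x) < s (b y)).

Lemma order_quotient_exists p : (forall i, exists x, b x = i) ->
  (forall i, order_module p (b @^-1: [set i])) -> exists s, order_quotient p s.
Proof.
move=> /fin_all_exists[first firstE] modp.
have [|s sE] := @perm_standardize k (fun i => p (first i)).
  by move=> i j /val_inj/perm_inj /(congr1 b); rewrite !firstE.
have neq_b z w : b z != b w -> z != w by apply: contraNneq => ->.
exists s => x y neq; rewrite sE.
transitivity (p x < p (first (b y))).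
  by apply: (modp (b y)); rewrite !inE ?firstE.
(* [order_module] only moves the right-hand side of a comparison, so the inequality is reversed
   before x is replaced by the chosen point of its block. *)
rewrite (@perm_lt_negb _ p x) ?[in RHS](@perm_lt_negb _ p (first (b x)));
  try by apply: neq_b; rewrite ?firstE.
by congr (~~ _); apply: (modp (b x)); rewrite !inE ?firstE // eq_sym.
Qed.

Lemma order_quotient_uniq p s s' : (forall i, exists x, b x = i) ->
  order_quotient p s -> order_quotient p s' -> s = s'.
Proof.
move=> b_surj quo quo'; apply: perm_eq_lt => i j.
case: (eqVneq i j) => [->|neq]; first by rewrite !ltnn.
have [x xi] := b_surj i; have [y yj] := b_surj j.
by rewrite -xi -yj -quo ?quo' ?xi ?yj.
Qed.

Lemma order_quotient_preim p s A :
  order_quotient p s -> order_module s A -> order_module p (b @^-1: A).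
Proof.
move=> quo modA x y z; rewrite !inE => xA yA zA.
have neq w : b w \in A -> b z != b w by move=> wA; apply: contraNneq zA => ->.
by rewrite !quo ?neq //; apply: modA.
Qed.

Lemma order_quotient_im p s A : (forall i, exists x, b x = i) ->
  order_quotient p s -> order_module p A -> order_module s (b @: A).
Proof.
move=> b_surj quo modA _ _ i /imsetP[x xA ->] /imsetP[y yA ->].
have [z <-] := b_surj i => zA.
have neq w : w \in A -> b z != b w.
  by move=> wA; apply: contraNneq zA => ->; apply: imset_f.
rewrite -!quo ?neq //; apply: modA => //.
by apply: contra zA; apply: imset_f.
Qed.

Lemma order_module1 m (s : 'S_m) (i : 'I_m) : order_module s [set i].
Proof. by move=> x y z; rewrite !inE => /eqP -> /eqP ->. Qed.

(* If I meets every block but misses a point of the block j, then I minus that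
   block is again an interval, whose image is the interval of all i != j. *)
Lemma proper_interval_in_block p s (I : {set 'I_n}) : 2 < k ->
  (forall i, exists x, b x = i) ->
  order_quotient 1%g 1%g -> order_quotient p s -> simple_perm s ->
  order_module 1%g I -> order_module p I -> I != setT ->
  {in I &, forall x y, b x = b y}.
Proof.
move=> k_gt2 b_surj quo1 quop s_simple mod1 modp IT.
have im A : order_module 1%g A -> order_module p A ->
    b @: A = setT \/ {in b @: A &, forall i j, i = j}.
  by move=> m1 mp; apply: (simple_perm_module s_simple);
    apply: order_quotient_im => //; [exact: quo1|exact: m1|exact: quop|exact: mp].
case: (im I mod1 modp) => [bI|bI x y xI yI]; last by apply: bI; apply: imset_f.
have [z zI] : exists z, z \notin I.
  by apply/existsP; rewrite -negb_forall; apply: contra IT => /forallP IT;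
    apply/eqP/setP => z; rewrite IT inE.
pose B := b @^-1: [set b z].
have zB : z \in B by rewrite !inE.
have modB p' s' : order_quotient p' s' -> order_module p' B.
  by move=> quo; apply: order_quotient_preim quo _; apply: order_module1.
have bID : b @: (I :\: B) = ~: [set b z].
  apply/setP => i; rewrite !inE; apply/imsetP/idP => [[x]|neq_i].
    by rewrite !inE => /andP[? _] ->.
  have : i \in b @: I by rewrite bI inE.
  by case/imsetP => x xI iE; exists x; rewrite // !inE -iE neq_i.
case: (im (I :\: B)); rewrite ?bID.
- exact: order_moduleD mod1 (modB _ _ quo1) zB zI.
- exact: order_moduleD modp (modB _ _ quop) zB zI.
- by move/setP/(_ (b z)); rewrite !inE eqxx.
- move=> one; have : #|~: [set b z]| <= 1.
    by apply/card_le1_eqP => v w vC wC; apply: one.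
  by have := cardsC [set b z]; rewrite cards1 card_ord; lia.
Qed.

End Quotient.

(** * Block maps determined by their block sizes or by their kernel *)

Section BlockMaps.
Context (n k : nat) (b : 'I_n -> 'I_k).
Context (b_mono : order_quotient b 1%g 1%g).

Lemma block_map_le (x y : 'I_n) : x <= y -> b x <= b y.
Proof.
rewrite leq_eqVlt => /orP[/eqP/val_inj -> //|lt_xy].
case: (eqVneq (b x) (b y)) => [-> //|neq].
by have := b_mono neq; rewrite !perm1; move: neq; rewrite -val_eqE /=; lia.
Qed.

(** As [b] is nondecreasing, the positions in blocks up to i form an initial segment, which is known
    from its size. *)
Lemma block_map_lt_card (x : 'I_n) (i : 'I_k) : (b x <= i) = (x < #|[set y | b y <= i]|).
Proof.
apply/idP/idP => [le_i|].
  rewrite -{1}(@card_lt_ord n x.+1) //; apply: subset_leq_card.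
  apply/subsetP => y; rewrite !inE ltnS => le_yx.
  exact: leq_trans (block_map_le le_yx) le_i.
apply: contraTT; rewrite -ltnNge => lt_i; rewrite -leqNgt.
rewrite -[leqRHS](card_lt_ord (ltnW (ltn_ord x))); apply: subset_leq_card.
apply/subsetP => y; rewrite !inE ltnNge => le_yi; apply: contraL le_yi.
by move/block_map_le; rewrite -ltnNge; apply: leq_trans.
Qed.

Lemma block_map_succ (x y : 'I_n) : (forall i, exists z, b z = i) ->
  y = x.+1 :> nat -> b x != b y -> b y = (b x).+1 :> nat.
Proof.
move=> b_surj yE neq; have le_xy : b x <= b y by apply: block_map_le; rewrite yE.
have lt_xy : b x < b y by rewrite ltn_neqAle neq.
apply/eqP; rewrite eqn_leq lt_xy andbT.
have [z bz] := b_surj (Ordinal (leq_ltn_trans lt_xy (ltn_ord (b y)))).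
have bzE : b z = (b x).+1 :> nat by rewrite bz.
rewrite -bzE; apply: block_map_le; rewrite yE ltnNge; apply/negP.
by move/block_map_le; rewrite bzE ltnn.
Qed.

End BlockMaps.

Lemma block_map_eq_card n k (b b' : 'I_n -> 'I_k) :
  order_quotient b 1%g 1%g -> order_quotient b' 1%g 1%g ->
  (forall i, #|b @^-1: [set i]| = #|b' @^-1: [set i]|) -> b =1 b'.
Proof.
move=> mono mono' eq_card x.
have cardE (c : 'I_n -> 'I_k) i :
    #|[set y | c y <= i]| = \sum_(j < k | j <= i) #|c @^-1: [set j]|.
  rewrite -sum1_card (partition_big c (fun j : 'I_k => j <= i)) /=; last first.
    by move=> y; rewrite inE.
  apply: eq_bigr => j le_ji; rewrite -sum1_card; apply: eq_bigl => y.
  by rewrite !inE; case: eqP => [->|]; rewrite ?le_ji ?andbF.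
have leE (i : 'I_k) : (b x <= i) = (b' x <= i).
  rewrite (block_map_lt_card mono) (block_map_lt_card mono') !cardE.
  by congr (_ < _); apply: eq_bigr.
by apply: val_inj; apply/eqP; rewrite /= eqn_leq leE leqnn /= -leE.
Qed.

(** Induction on the position: both maps start at 0, and moving to the next position adds 1 exactly
    when the block changes, which the common kernel decides. *)
Lemma block_map_eq_ker n k k' (b : 'I_n -> 'I_k) (b' : 'I_n -> 'I_k') :
  order_quotient b 1%g 1%g -> order_quotient b' 1%g 1%g ->
  (forall i, exists x, b x = i) -> (forall i, exists x, b' x = i) ->
  (forall x y, (b x == b y) = (b' x == b' y)) ->
  k = k' /\ (forall x, b x = b' x :> nat).
Proof.
move=> mono mono' surj surj' ker.
have first0 l (c : 'I_n -> 'I_l) (x : 'I_n) : order_quotient c 1%g 1%g ->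
    (forall i, exists y, c y = i) -> x = 0 :> nat -> c x = 0 :> nat.
  move=> cmono csurj x0; apply/eqP; rewrite -leqn0.
  have [y cy] := csurj (Ordinal (leq_ltn_trans (leq0n _) (ltn_ord (c x)))).
  have -> : 0 = c y :> nat by rewrite cy.
  by apply: block_map_le => //; rewrite x0.
have bE v (x : 'I_n) : x = v :> nat -> b x = b' x :> nat.
  elim: v x => [|v IHv] x xv; first by rewrite !first0.
  have lt_vn : v < n by rewrite ltnW // -xv.
  have := IHv (Ordinal lt_vn) erefl; set y := Ordinal lt_vn => yE.
  case: (eqVneq (b y) (b x)) => [byx|neq].
    by rewrite -byx yE; move/eqP: byx; rewrite ker => /eqP ->.
  rewrite (block_map_succ (x := y) mono surj xv neq) // yE.
  by rewrite (block_map_succ (x := y) mono' surj' xv) -?ker.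
have le l l' (c : 'I_n -> 'I_l) (c' : 'I_n -> 'I_l') :
    (forall i, exists x, c x = i) -> (forall x, c x = c' x :> nat) -> l <= l'.
  case: l c => // l c csurj cE; have [x cx] := csurj ord_max.
  by have := ltn_ord (c' x); rewrite -cE cx.
split=> [|x]; last exact: bE erefl.
by apply/eqP; rewrite eqn_leq (le _ _ b b') ?(le _ _ b' b) // => x; rewrite (bE x).
Qed.

(** * Inflations *)

Section InflationOrder.
Context (k : nat) (m : 'I_k -> nat).
Implicit Types (s : 'S_k) (a : forall i, 'S_(m i)).

Lemma sig1_order_quotient : order_quotient (@tagnat.sig1 k m) 1%g 1%g.
Proof.
move=> x y neq; rewrite !perm1.
have := @tagnat.le_sig1 _ m x y; have := @tagnat.le_sig1 _ m y x.
by rewrite !Order.OrdinalOrder.leEord /=; move: neq; rewrite -val_eqE /=; lia.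
Qed.

Lemma sig1_fiber_card i : #|@tagnat.sig1 k m @^-1: [set i]| = m i.
Proof.
rewrite -[RHS]card_ord -(card_imset _ (f := @tagnat.Rank _ m i)).
  apply: eq_card => x; rewrite !inE; apply/eqP/imsetP => [<-|[j _ ->]].
    by exists (tagnat.sig2 x); rewrite ?tagnat.sig2K.
  exact: tagnat.Rank1K.
by move=> j j' /eqP; rewrite -val_eqE /= tagnat.eq_Rank eqxx => /eqP/val_inj.
Qed.

Lemma inflation_order_quotient s a :
  order_quotient (@tagnat.sig1 k m) (inflation s a) s.
Proof.
have lt_infl x y : s (tagnat.sig1 x) < s (tagnat.sig1 y) ->
    inflation s a x < inflation s a y.
  move=> lt_s; rewrite !inflationE; apply: leq_trans (infl_val_lt_next _ lt_s) _.
  exact: leq_addr.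
move=> x y neq; case: (ltngtP (s _)) => [lt_s|lt_s|/val_inj/perm_inj eq_s].
- exact: lt_infl.
- by apply/negbTE; rewrite -leqNgt ltnW // lt_infl.
- by rewrite eq_s eqxx in neq.
Qed.

Lemma inflation_Rank s a i (j : 'I_(m i)) :
  inflation s a (tagnat.Rank _ j) = \sum_(i' < k | s i' < s i) m i' + a i j :> nat.
Proof.
by rewrite inflationE /infl_val /tagnat.sig1 /tagnat.sig2 /tagnat.Rank tagnat.rankK.
Qed.

Context (m_gt0 : forall i, 0 < m i).

Lemma sig1_surj i : exists x, @tagnat.sig1 k m x = i.
Proof. by exists (tagnat.Rank _ (Ordinal (m_gt0 i))); rewrite tagnat.Rank1K. Qed.

(** As blocks are nonempty, [s] is determined as a quotient. Inside block i the values are those of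
    [a i] up to a constant shift, which comparing two entries removes. *)
Lemma inflation_inj s s' a a' :
  inflation s a = inflation s' a' -> s = s' /\ forall i, a i = a' i.
Proof.
move=> eq_infl; split=> [|i].
  apply: (order_quotient_uniq sig1_surj (inflation_order_quotient s a)).
  by rewrite eq_infl; apply: inflation_order_quotient.
apply: perm_eq_lt => x y.
have eqR z : inflation s a (@tagnat.Rank _ m i z) =
    inflation s' a' (tagnat.Rank _ z) :> nat by rewrite eq_infl.
have := eqR x; have := eqR y; rewrite !inflation_Rank.
set S := (\sum_(_ < k | _) _); set S' := (\sum_(_ < k | _) _).
by lia.
Qed.

Lemma inflation_exists (p : 'S_(\sum_i m i)) s :
  order_quotient tagnat.sig1 p s -> exists a, p = inflation s a.
Proof.
move=> quo.
have /fin_all_exists[a aE] i : exists a : 'S_(m i),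
    forall x y, (a x < a y) = (p (tagnat.Rank _ x) < p (tagnat.Rank _ y)).
  apply: (@perm_standardize _ (fun x => p (tagnat.Rank _ x))).
  move=> x y /val_inj/perm_inj /eqP; rewrite -val_eqE /= tagnat.eq_Rank eqxx.
  by move/eqP/val_inj.
exists a; apply: perm_eq_lt => x y.
case: (eqVneq (tagnat.sig1 x) (tagnat.sig1 y)) => [eq_xy|neq]; last first.
  by rewrite inflation_order_quotient // quo.
rewrite -(tagnat.sig2K x) -(tagnat.sig2K y).
move: (tagnat.sig2 x) (tagnat.sig2 y); rewrite eq_xy => i j.
by rewrite !inflation_Rank ltn_add2l aE.
Qed.

End InflationOrder.

(** [inflation s a] lives in ['S_(\sum_i m i)], so reaching ['S_n] takes the equality of sizes [e]
    and [cast_perm]. *)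
Definition inflated n k (Sg : pred 'S_k) (m : 'I_k -> nat)
    (A : forall i, pred 'S_(m i)) (p : 'S_n) : Prop :=
  exists (e : \sum_i m i = n) s a,
    [/\ Sg s, forall i, A i (a i) & p = cast_perm e (inflation s a)].

(** Block sizes determine a block map, so [b] is the canonical [tagnat.sig1] and [inflation_exists]
    applies. *)
Lemma inflated_of_blocks n k (m : 'I_k -> nat) (b : 'I_n -> 'I_k) p s :
  order_quotient b 1%g 1%g -> (forall i, #|b @^-1: [set i]| = m i) ->
  order_quotient b p s -> inflated (pred1 s) (fun i => xpredT) p (m := m).
Proof.
move=> mono cardb quo.
have e : \sum_i m i = n.
  rewrite -[RHS]card_ord -sum1_card (partition_big b xpredT) //=.
  apply: eq_bigr => i _; rewrite -cardb -sum1_card; apply: eq_bigl => x.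
  by rewrite !inE.
case: n / e b p mono cardb quo => b p mono cardb.
have /funext -> : b =1 tagnat.sig1.
  apply: block_map_eq_card mono (@sig1_order_quotient _ _) _ => i.
  by rewrite cardb sig1_fiber_card.
by case/inflation_exists => a ->; exists erefl, s, a; split=> //=.
Qed.

Section Inflated.
Context (k : nat) (Sg : pred 'S_k) (m : 'I_k -> nat).
Context (A : forall i, pred 'S_(m i)).
Context (A_gt0 : forall i a, A (i := i) a -> 0 < m i).

(** [A_gt0] makes all blocks nonempty, so [s] and the [a i] can be read off the inflation, and
    counting inflations is counting these choices. *)
Lemma card_inflated n : \sum_i m i = n ->
  #|[pred p : 'S_n | `[< inflated Sg A p >]]| = #|Sg| * \prod_i #|A (i := i)|.
Proof.
case: n /; pose D := [predX Sg & family (fun i => [pred a | A (i := i) a])].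
pose f (sa : 'S_k * {dffun forall i, 'S_(m i)}) := inflation sa.1 sa.2.
have f_inj : {in D &, injective f}.
  move=> [s a] [s' a'] /andP[_ /familyP aA] _ /inflation_inj [|/= -> eqa].
    by move=> i; apply: A_gt0 (aA i).
  by congr pair; apply/ffunP.
transitivity #|[set f sa | sa in D]|.
  apply: eq_card => p; rewrite inE; apply/asboolP/imsetP.
    case=> e [s [a [sS aA ->]]]; exists (s, [ffun i => a i] : {dffun forall i, 'S_(m i)}).
      by apply/andP; split=> //; apply/familyP => i; rewrite /= ffunE; apply: aA.
    rewrite cast_perm_id /f /=; congr inflation.
    by apply/functional_extensionality_dep => i; rewrite ffunE.
  case=> -[s a] /andP[sS /familyP aA] ->; exists erefl, s, a.
  by split=> //; apply: aA.
rewrite card_in_imset // cardX card_family; congr (_ * _).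
by rewrite foldrE big_map big_enum.
Qed.

Lemma inflated_blocks n (p : 'S_n) : inflated Sg A p -> exists s b,
  [/\ Sg s, order_quotient b 1%g 1%g, order_quotient b p s,
      forall i : 'I_k, exists x, b x = i & forall i, #|b @^-1: [set i]| = m i].
Proof.
case=> e; move: p; case: n / e => p [s [a [sS aA ->]]]; rewrite cast_perm_id.
exists s, (@tagnat.sig1 k m); split=> //.
- exact: sig1_order_quotient.
- exact: inflation_order_quotient.
- by apply: sig1_surj => i; apply: A_gt0 (aA i).
- exact: sig1_fiber_card.
Qed.

End Inflated.

(** * Existence of a simple quotient and uniqueness of its blocks *)

Lemma order_quotient_comp n k l (b : 'I_n -> 'I_k) (c : 'I_k -> 'I_l) p s t :
  order_quotient b p s -> order_quotient c s t -> order_quotient (c \o b) p t.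
Proof.
move=> quob quoc x y /= neq; rewrite quob ?quoc //.
by apply: contraNneq neq => ->.
Qed.

(** [c] collapses the interval from i to j to a point. This loses points as i < j, and leaves at
    least two as the interval is not everything. *)
Lemma merge_blocks k (s : 'S_k) (i j : 'I_k) : i < j -> (0 < i) || (j.+1 < k) ->
  order_module s [set l : 'I_k | i <= l <= j] ->
  exists k' (c : 'I_k -> 'I_k') t, [/\ 1 < k' < k, order_quotient c 1%g 1%g,
    forall l, exists x, c x = l & order_quotient c s t].
Proof.
move=> lt_ij proper mods; have lt_jk := ltn_ord j.
case: k => [|k] in s i j lt_ij proper mods lt_jk *; first by rewrite ltn0 in lt_jk.
(* d points disappear; [s] now has [k.+1] entries, so [(k - d).+1] remain. *)
have [d dE] : {d | d = j - i} by exists (j - i).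
pose c (l : 'I_k.+1) : 'I_(k - d).+1 :=
  inord (if l <= i then l : nat else if l <= j then i : nat else l - d).
have cE l : c l = (if l <= i then l : nat else if l <= j then i : nat else l - d) :> nat.
  by rewrite inordK //; have := ltn_ord l; do ?case: ifP => ? /=; lia.
have c_surj l : exists x, c x = l.
  have := ltn_ord l; case: (leqP l i) => [le_li|lt_il] lt_l.
    have lt_lk : l < k.+1 by lia.
    by exists (Ordinal lt_lk); apply: ord_inj; rewrite cE /= le_li.
  have lt_lk : l + d < k.+1 by lia.
  by exists (Ordinal lt_lk); apply: ord_inj; rewrite cE /=; do ?case: ifP => ?; lia.
have [|t quo] := @order_quotient_exists _ _ c s c_surj.
  move=> v x y z; rewrite !inE => /eqP <- /eqP cyx czx.
  case: (eqVneq x y) => [->//|neq_xy].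
  apply: mods; rewrite !inE; move: cyx czx neq_xy => /(congr1 val) /=;
    rewrite -!val_eqE /= !cE; do ?case: ifP => ?; lia.
exists (k - d).+1, c, t; split=> //; first by lia.
move=> x y; rewrite !perm1 -val_eqE /= !cE; do ?case: ifP => ?; lia.
Qed.

(** Starting from singletons, blocks are merged along an interval as long as the quotient is not
    simple; their number decreases but stays above 1. *)
Lemma simple_quotient_exists n (p : 'S_n) : 1 < n ->
  exists k (b : 'I_n -> 'I_k) s, [/\ 1 < k, simple_perm s,
    order_quotient b 1%g 1%g, forall i, exists x, b x = i & order_quotient b p s].
Proof.
move=> n_gt1.
suff coarsen k : 1 < k -> forall (b : 'I_n -> 'I_k) s,
    order_quotient b 1%g 1%g -> (forall i, exists x, b x = i) ->
    order_quotient b p s -> exists k (b : 'I_n -> 'I_k) s, [/\ 1 < k,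
    simple_perm s, order_quotient b 1%g 1%g, forall i, exists x, b x = i
    & order_quotient b p s].
  by apply: (coarsen n n_gt1 id p) => // i; [exists i].
elim/ltn_ind: k => k IHk k_gt1 b s mono surj quo.
case: (boolP (simple_perm s)) => [s_simple|]; first by exists k, b, s.
case/nonsimple_perm_module => i [j [lt_ij proper mods]].
have [k' [c [t [/andP[k'_gt1 lt_k'k] cmono csurj cquo]]]] :=
  merge_blocks lt_ij proper mods.
apply: (IHk k' lt_k'k k'_gt1 (c \o b) t).
- exact: order_quotient_comp mono cmono.
- by move=> l; have [y <-] := csurj l; have [x <-] := surj y; exists x.
- exact: order_quotient_comp quo cquo.
Qed.

(** Neither the first two nor the last two positions may form an interval, so the last value lies
    between the other two, and so does the first: a contradiction. *)
Lemma simple_perm_size_neq3 (s : 'S_3) : ~~ simple_perm s.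
Proof.
apply/negP => s_simple.
have mod2 (A : {set 'I_3}) (x y z : 'I_3) : A = ~: [set z] -> x != y ->
    x \in A -> y \in A -> order_module 1%g A -> (s z < s x) != (s z < s y).
  move=> AE neq xA yA mod1; apply/negP => /eqP eq_s.
  have zA : z \notin A by rewrite AE !inE eqxx.
  have memA u : u \in A -> u = x \/ u = y.
    move=> uA; have : [set x; y; z] = setT.
      apply/eqP; rewrite eqEcard subsetT cardsT card_ord.
      rewrite setUC cardsU1 !inE cards2 neq negb_or.
      by rewrite !(contraNneq _ zA) // => ->.
    move/setP/(_ u); rewrite !inE => /orP[/orP[]|] /eqP; [left|right|] => //.
    by move=> uz; rewrite uz (negbTE zA) in uA.
  have mods : order_module s A.
    move=> u v w uA vA; rewrite AE !inE negbK => /eqP ->.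
    by case: (memA u uA) => ->; case: (memA v vA) => ->.
  case: (simple_perm_module s_simple mod1 mods) => [AT|A1].
    by rewrite AT inE in zA.
  by rewrite (A1 x y) // eqxx in neq.
pose i0 : 'I_3 := inord 0; pose i1 : 'I_3 := inord 1; pose i2 : 'I_3 := inord 2.
have := mod2 (~: [set i2]) i0 i1 i2 erefl; have := mod2 (~: [set i0]) i1 i2 i0 erefl.
have neq : [/\ i0 != i1, i1 != i2 & i0 != i2] by rewrite -!val_eqE /= !inordK.
case: neq => n01 n12 n02; rewrite !inE !(eq_sym i2) !(eq_sym i1 i0) n01 n12 n02.
have s01 : s i0 != s i1 by rewrite (inj_eq perm_inj).
have s12 : s i1 != s i2 by rewrite (inj_eq perm_inj).
have s02 : s i0 != s i2 by rewrite (inj_eq perm_inj).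
move: s01 s12 s02; rewrite -!val_eqE /= => s01 s12 s02.
move=> /(_ isT isT isT) H1 /(_ isT isT isT) H2.
have /H1 : order_module 1%g (~: [set i0]).
  move=> x y z; rewrite !inE negbK !perm1 => x0 y0 /eqP ->.
  by move: x0 y0; rewrite -!val_eqE /= !inordK //; lia.
have /H2 : order_module 1%g (~: [set i2]).
  move=> x y z; rewrite !inE negbK !perm1 => x0 y0 /eqP ->.
  have := ltn_ord x; have := ltn_ord y.
  by move: x0 y0; rewrite -!val_eqE /= !inordK //; lia.
by clear H1 H2 mod2; lia.
Qed.

(** A block of [b] is an interval and not everything, so it lies inside one block of [b']. Used in
    both directions, this gives equal kernels. *)
Lemma blocks_ker_sub n (p : 'S_n) k k' (b : 'I_n -> 'I_k) (b' : 'I_n -> 'I_k') s s' :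
  2 < k -> 2 < k' -> simple_perm s' ->
  order_quotient b 1%g 1%g -> order_quotient b' 1%g 1%g ->
  (forall i, exists x, b x = i) -> (forall i, exists x, b' x = i) ->
  order_quotient b p s -> order_quotient b' p s' ->
  forall x y, b x = b y -> b' x = b' y.
Proof.
move=> k_gt2 k'_gt2 s'_simple mono mono' surj surj' quo quo' x y bxy.
pose I := b @^-1: [set b x].
have modI q t : order_quotient b q t -> order_module q I.
  by move=> qt; apply: order_quotient_preim qt _; apply: order_module1.
apply: (proper_interval_in_block k'_gt2 surj' mono' quo' s'_simple (I := I)).
- exact: modI mono.
- exact: modI quo.
- apply/negP => /eqP IT; have lt0 : 0 < k by lia.
  have lt1 : 1 < k by lia.
  have [z0 z0E] := surj (Ordinal lt0); have [z1 z1E] := surj (Ordinal lt1).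
  have : z0 \in I by rewrite IT inE.
  have : z1 \in I by rewrite IT inE.
  by rewrite !inE z0E z1E => /eqP <- /eqP /(congr1 val).
- by rewrite !inE.
- by rewrite !inE bxy.
Qed.

(** * Counting simple inflations by shape *)

Definition long_simple k : pred 'S_k := fun s => (4 <= k) && simple_perm s.

Section SimpleInflations.
Context (P : forall n, pred 'S_n).
Context (P_gt0 : forall n (p : 'S_n), P p -> 0 < n).

Definition simple_inflation n (p : 'S_n) : Prop :=
  exists k (m : 'I_k -> nat),
    inflated (@long_simple k) (fun i => @P (m i)) p.

(* Bounding the number of blocks and their sizes by n makes shapes a finType. *)
Definition shape n : finType := {k : 'I_n.+1 & {ffun 'I_k -> 'I_n.+1}}.

Definition shape_inflation n (j : shape n) (p : 'S_n) : Prop :=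
  inflated (@long_simple (tag j)) (fun i => @P (tagged j i)) p.

Lemma inflated_shape_uniq n (p : 'S_n) (j j' : shape n) :
  shape_inflation j p -> shape_inflation j' p -> j = j'.
Proof.
case: j j' => k m [k' m'] /inflated_blocks[|s [b []]]; first by move=> i a /P_gt0.
move=> /andP[/= k_gt3 s_simple] mono quo surj cardm.
case/inflated_blocks => [|s' [b' []]]; first by move=> i a /P_gt0.
move=> /andP[/= k'_gt3 s'_simple] mono' quo' surj' cardm'.
have [kk' bb'] : nat_of_ord k = k' /\ (forall x, b x = b' x :> nat).
  apply: block_map_eq_ker => // x y; apply/eqP/eqP.
    by apply: (blocks_ker_sub _ _ s'_simple mono mono' surj surj' quo quo'); apply: ltnW.
  by apply: (blocks_ker_sub _ _ s_simple mono' mono surj' surj quo' quo); apply: ltnW.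
move/val_inj: kk' => kk'; case: _ / kk' in m' s' b' cardm' bb' {k'_gt3 s'_simple mono' quo' surj'} *.
congr Tagged; apply/ffunP => i; apply: val_inj; rewrite /= -cardm -cardm'.
by apply: eq_card => x; rewrite !inE -!val_eqE /= bb'.
Qed.

Lemma simple_inflationP n (p : 'S_n) :
  simple_inflation p <-> exists j : shape n, shape_inflation j p.
Proof.
split=> [[k [m infl]]|[[k m] infl]]; last by exists k, (fun i => nat_of_ord (m i)).
have [e [s [a [_ aP _]]]] := infl.
have m_le i : m i < n.+1 by rewrite ltnS -e (bigD1 i) //= leq_addr.
have k_le : k < n.+1.
  rewrite ltnS -[k]card_ord -sum1_card -[leqRHS]e; apply: leq_sum => i _.
  exact: P_gt0 (aP i).
have [m' mE] : exists m' : {ffun 'I_k -> 'I_n.+1}, m = fun i => m' i.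
  by exists [ffun i => Ordinal (m_le i)]; apply/funext => i; rewrite ffunE.
move: infl; rewrite mE => infl.
by exists (existT (fun k : 'I_n.+1 => {ffun 'I_k -> 'I_n.+1}) (Ordinal k_le) m').
Qed.

Lemma shape_inflation_card n (j : shape n) :
  #|[pred p : 'S_n | `[< shape_inflation j p >]]|
    = if \sum_i tagged j i == n :> nat
      then #|@long_simple (tag j)| * \prod_i #|@P (tagged j i)| else 0.
Proof.
case: eqP => [e|ne]; first by apply: card_inflated => // i a /P_gt0.
by apply: eq_card0 => p; rewrite inE; apply/asboolP => -[].
Qed.

Lemma simple_inflation_card n :
  #|[pred p : 'S_n | `[< simple_inflation p >]]|
   = \sum_(k < n.+1) \sum_(m : {ffun 'I_k -> 'I_n.+1} | \sum_i m i == n :> nat)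
       #|@long_simple k| * \prod_i #|@P (m i)|.
Proof.
transitivity (\sum_(j : shape n) #|[pred p : 'S_n | `[< shape_inflation j p >]]|).
  (* Double counting of pairs of a permutation and a shape: by uniqueness of the shape, each inner
     sum is 0 or 1. *)
  transitivity (\sum_(p : 'S_n) \sum_(j : shape n) `[< shape_inflation j p >]).
    rewrite -sum1_card big_mkcond; apply: eq_bigr => p _; rewrite inE.
    case: asboolP => [/simple_inflationP[j pj]|np].
      rewrite (bigD1 j) //= (asboolT pj) big1 // => j' neq.
      rewrite asboolF // => pj'; move: neq.
      by rewrite (inflated_shape_uniq pj' pj) eqxx.
    rewrite big1 // => j _; rewrite asboolF // => pj; apply: np.
    by apply/simple_inflationP; exists j.
  rewrite exchange_big; apply: eq_bigr => j _; rewrite -sum1_card [RHS]big_mkcond.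
  by apply: eq_bigr => p _; rewrite inE; case: asboolP.
under eq_bigr do rewrite shape_inflation_card.
rewrite -big_mkcond /=.
by rewrite (sig_big_dep (fun k : 'I_n.+1 => true)
  (fun (k : 'I_n.+1) (m : {ffun 'I_k -> 'I_n.+1}) => \sum_i m i == n :> nat)
  (fun k m => #|@long_simple k| * \prod_i #|@P (m i)|)).
Qed.

End SimpleInflations.

(** * Generating series *)

Local Open Scope ring_scope.

(** Truncation gives a power of a polynomial, expanded by distributivity. The bound on the exponents
    matches the index set of [simple_inflation_card]. *)
Lemma fps_coef_exp (R : comNzRingType) (f : {fps R}) k n :
  (f ^+ k) n = \sum_(m : {ffun 'I_k -> 'I_n.+1} | (\sum_i m i)%N == n)
                 \prod_i f (m i).
Proof.
rewrite (fps_coefX_trunc _ _ (ltnSn n)) /fps_trunc poly_def.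
have -> : (\sum_(i < n.+1) f i *: 'X^i) ^+ k =
    \prod_(j < k) (\sum_(i < n.+1) f i *: 'X^i) by rewrite prodr_const card_ord.
rewrite bigA_distr_bigA coef_sum [RHS]big_mkcond; apply: eq_bigr => m _ /=.
rewrite scaler_prod coefZ prodrXr coefXn eq_sym.
by case: eqP => _; rewrite ?mulr1 ?mulr0.
Qed.

Definition card_series (P : forall n, pred 'S_n) : {fps rat} :=
  Fps (fun n => #|@P n|%:R).

Lemma simple_inflation_series (P : forall n, pred 'S_n) :
  (forall n (p : 'S_n), P n p -> (0 < n)%N) ->
  card_series (fun n p => `[< simple_inflation P p >])
    = fps_comp (card_series long_simple) (card_series P).
Proof.
move=> P_gt0; apply/fpsP => n; rewrite [LHS](_ : _ =
  #|[pred p : 'S_n | `[< simple_inflation P p >]]|%:R); last first.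
  by congr (_%:R); apply: eq_card.
rewrite simple_inflation_card // natr_sum; apply: eq_bigr => k _.
rewrite fps_coef_exp natr_sum mulr_sumr; apply: eq_bigr => m _.
by rewrite natrM natr_prod.
Qed.

Local Open Scope nat_scope.

Lemma simple_inflation_size (P : forall n, pred 'S_n) n (p : 'S_n) :
  (forall n (p : 'S_n), P n p -> 0 < n) -> simple_inflation P p -> 3 < n.
Proof.
move=> P_gt0 [k [m [e [s [a [/andP[k_gt3 _] aP _]]]]]].
apply: leq_trans k_gt3 _; rewrite -[k]card_ord -sum1_card -[leqRHS]e.
by apply: leq_sum => i _; apply: P_gt0 (aP i).
Qed.

(** * Block-wise simple permutations as simple inflations *)

Definition blockwise_simpleb n : pred 'S_n := fun p => `[< blockwise_simple p >].

Lemma blockwise_simple_gt0 n (p : 'S_n) : blockwise_simple p -> 0 < n.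
Proof.
elim=> // k s m a k_gt3 _ _ m_gt0.
by rewrite (bigD1 (Ordinal (ltnW (ltnW (ltnW k_gt3))))) //= ltn_addr.
Qed.

Lemma blockwise_simpleb_gt0 n (p : 'S_n) : blockwise_simpleb p -> 0 < n.
Proof. by move/asboolP/blockwise_simple_gt0. Qed.

(** One unfolding of the inductive definition, the source of W = x + S(W). *)
Lemma blockwise_simpleP n (p : 'S_n) :
  blockwise_simple p <-> n = 1 \/ simple_inflation blockwise_simpleb p.
Proof.
split=> [[q|k s m a k_gt3 s_simple a_bs]|].
- by left.
- right; exists k, m, erefl, s, a; split=> //; first exact/andP.
  by move=> i; apply/asboolP.
- case=> [n1|[k [m [e [s [a [/andP[k_gt3 s_simple] a_bs ->]]]]]]].
    by case: _ / (esym n1) p => p; apply: blockwise_simple_one.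
  case: n / e {p}; rewrite cast_perm_id; apply: blockwise_simple_infl => // i.
  exact/asboolP/a_bs.
Qed.

(** * Sum-decomposable permutations *)

Definition sum_cut n (p : 'S_n) (c : nat) : bool :=
  [forall x : 'I_n, forall y : 'I_n, (x < c <= y) ==> (p x < p y)].

Lemma sum_cutP n (p : 'S_n) c :
  reflect (forall x y : 'I_n, x < c <= y -> p x < p y) (sum_cut p c).
Proof.
apply: (iffP forallP) => [cut x y|cut x]; first by have /forallP/(_ y)/implyP := cut x.
by apply/forallP => y; apply/implyP/cut.
Qed.

(** The type of [c] gives c < n, so both summands are nonempty. *)
Definition sum_decomposable n : pred 'S_n :=
  fun p => [exists c : 'I_n, (0 < c) && sum_cut p c].

Definition rev_perm n : 'S_n := perm (@rev_ord_inj n).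

(** [p * rev_perm n] applies [p] first: values are reversed, positions kept. *)
Definition skew_decomposable n : pred 'S_n :=
  fun p => sum_decomposable (p * rev_perm n)%g.

Lemma mul_rev_perm_lt n (p : 'S_n) x y :
  ((p * rev_perm n)%g x < (p * rev_perm n)%g y) = (p y < p x).
Proof.
by rewrite !permM !permE /=; have := ltn_ord (p x); have := ltn_ord (p y); lia.
Qed.

Lemma order_module_rev n (p : 'S_n) A :
  order_module (p * rev_perm n)%g A -> order_module p A.
Proof.
move=> modA x y z xA yA zA.
have neq u : u \in A -> z != u by move=> uA; apply: contraNneq zA => ->.
rewrite (perm_lt_negb p (neq x xA)) (perm_lt_negb p (neq y yA)).
by congr (~~ _); have := modA x y z xA yA zA; rewrite !mul_rev_perm_lt.
Qed.

Lemma sum_cut_module n (p : 'S_n) c : sum_cut p c ->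
  order_module p [set x : 'I_n | x < c] /\ order_module p (~: [set x : 'I_n | x < c]).
Proof.
move/sum_cutP => cut; split=> x y z; rewrite !inE ?negbK -!leqNgt => xc yc zc.
  have := cut x z; have := cut y z; rewrite xc yc zc => /(_ isT) yz /(_ isT) xz.
  by rewrite !(ltnNge (p z)) (ltnW xz) (ltnW yz).
by rewrite (cut z x) ?(cut z y) ?zc.
Qed.

(** Both sides of the cut are proper intervals, so each lies in a single block, whereas there are at
    least three blocks. *)
Lemma simple_inflation_no_cut n (p : 'S_n) k (b : 'I_n -> 'I_k) s (c : 'I_n) :
  2 < k -> simple_perm s -> order_quotient b 1%g 1%g ->
  (forall i, exists x, b x = i) -> order_quotient b p s -> 0 < c ->
  order_module p [set x : 'I_n | x < c] ->
  order_module p (~: [set x : 'I_n | x < c]) -> False.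
Proof.
move=> k_gt2 s_simple mono surj quo c_gt0 modL modH.
have [modL1 modH1] : order_module 1%g [set x : 'I_n | x < c] /\
    order_module 1%g (~: [set x : 'I_n | x < c]).
  by apply/sum_cut_module/sum_cutP => x y /andP[]; rewrite !perm1; apply: leq_trans.
have const := proper_interval_in_block k_gt2 surj mono quo s_simple.
have bL (x y : 'I_n) : x < c -> y < c -> b x = b y.
  move=> xc yc; apply: (const _ modL1 modL); rewrite ?inE //.
  by apply/eqP => /setP /(_ c); rewrite !inE ltnn.
have bH (x y : 'I_n) : c <= x -> c <= y -> b x = b y.
  move=> xc yc; apply: (const _ modH1 modH); rewrite ?inE -?leqNgt //.
  apply/eqP => /setP /(_ (Ordinal (leq_ltn_trans (leq0n c) (ltn_ord c)))).
  by rewrite !inE /= c_gt0.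
have [k0 k1] : 0 < k /\ 1 < k by lia.
have [x0 b0] := surj (Ordinal k0); have [x1 b1] := surj (Ordinal k1).
have [x2 b2] := surj (Ordinal k_gt2).
have n01 : b x0 <> b x1 by rewrite b0 b1 => /(congr1 val).
have n02 : b x0 <> b x2 by rewrite b0 b2 => /(congr1 val).
have n12 : b x1 <> b x2 by rewrite b1 b2 => /(congr1 val).
case: (ltnP x0 c) => h0; case: (ltnP x1 c) => h1; case: (ltnP x2 c) => h2;
  by [case: n01; auto | case: n02; auto | case: n12; auto].
Qed.

Definition nonempty n : pred 'S_n := fun=> 0 < n.

Lemma perm_trichotomy n (p : 'S_n) : 1 < n ->
  `[< simple_inflation nonempty p >] + sum_decomposable p + skew_decomposable p = 1.
Proof.
move=> n_gt1.
(* [q] will be [p] or its value reversal, whose modules are also modules of [p]. *)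
have infl_cut q : sum_decomposable q -> (forall A, order_module q A -> order_module p A) ->
    ~ simple_inflation nonempty p.
  case/existsP => c /andP[c_gt0 /sum_cut_module[modL modH]] qp [k [m]].
  case/inflated_blocks=> [//|s [b [/andP[k_gt3 s_simple] mono quo surj _]]].
  exact: (simple_inflation_no_cut (ltnW k_gt3) s_simple mono surj quo c_gt0 (qp _ modL) (qp _ modH)).
(* The first and last entries decide: a sum cut makes the first one the smaller, a skew cut the
   larger. *)
have sum_skew : sum_decomposable p -> ~~ skew_decomposable p.
  case/existsP => c /andP[c_gt0 /sum_cutP cut].
  apply/existsPn => d; rewrite negb_and; case: (posnP d) => //= d_gt0.
  apply/sum_cutP => cut'; case: n p c c_gt0 cut d d_gt0 cut' n_gt1 {infl_cut} => // n.
  move=> p c c_gt0 cut d d_gt0 cut' _.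
  have := cut' ord0 ord_max; rewrite d_gt0 -ltnS ltn_ord mul_rev_perm_lt => /(_ isT).
  have := cut ord0 ord_max; rewrite c_gt0 -ltnS ltn_ord => /(_ isT).
  by move=> lt01 /(ltn_trans lt01); rewrite ltnn.
(* A simple quotient with at least four points exhibits an inflation, one with two points gives a
   cut after the first block, and three points are impossible. *)
have cover : ~~ sum_decomposable p -> ~~ skew_decomposable p ->
    simple_inflation nonempty p.
  move=> nsum nskew.
  have [k [b [s [k_gt1 s_simple mono surj quo]]]] := simple_quotient_exists p n_gt1.
  case: (ltnP 3 k) => [k_gt3|k_le3].
    exists k, (fun i => #|b @^-1: [set i]|).
    have [e [_ [a [/eqP -> _ ->]]]] := inflated_of_blocks mono (fun=> erefl) quo.
    exists e, s, a; split=> //; first exact/andP.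
    move=> i; rewrite /nonempty card_gt0; apply/set0Pn.
    by have [x <-] := surj i; exists x; rewrite !inE.
  have [k2|k3] : k = 2 \/ k = 3 by lia.
    subst k; exfalso; pose c := #|[set y | b y <= (ord0 : 'I_2)]|.
    have ltc (x : 'I_n) : (x < c) = (b x <= (ord0 : 'I_2)) by rewrite (block_map_lt_card mono).
    have [x0 b0] := surj ord0; have [x1 b1] := surj ord_max.
    have c_gt0 : 0 < c by rewrite (leq_ltn_trans (leq0n x0)) // ltc b0.
    have c_lt_n : c < n by rewrite (leq_ltn_trans _ (ltn_ord x1)) // leqNgt ltc b1.
    have bE (x y : 'I_n) : x < c <= y -> b x = ord0 /\ b y = ord_max.
      rewrite (leqNgt c y) !ltc => /andP[]; rewrite leqn0 -ltnNge => /eqP bx0 by0.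
      by split; apply: ord_inj => //=; apply/eqP; rewrite eqn_leq by0 -ltnS ltn_ord.
    case: (ltngtP (s ord0) (s ord_max)) => [lt_s|lt_s|/val_inj/perm_inj //].
      case/negP: nsum; apply/existsP; exists (Ordinal c_lt_n); rewrite c_gt0 /=.
      by apply/sum_cutP => x y /bE[bx by0]; rewrite quo bx by0.
    case/negP: nskew; apply/existsP; exists (Ordinal c_lt_n); rewrite c_gt0 /=.
    by apply/sum_cutP => x y /bE[bx by0]; rewrite mul_rev_perm_lt quo bx by0.
  by subst k; move: (simple_perm_size_neq3 s); rewrite s_simple.
case: asboolP => infl; case: (boolP (sum_decomposable p)) => psum;
  case: (boolP (skew_decomposable p)) => pskew //=.
- by case: (infl_cut p psum) => // A.
- by case: (infl_cut p psum) => // A.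
- by case: (infl_cut _ pskew) => // A; apply: order_module_rev.
- by rewrite (negbTE (sum_skew psum)) in pskew.
- by case: infl; apply: cover.
Qed.

Lemma skew_decomposable_card n :
  #|@skew_decomposable n| = #|@sum_decomposable n|.
Proof.
rewrite -!sum1_card [RHS](reindex_inj (mulIg (rev_perm n))) /=.
exact: eq_bigl.
Qed.

Section DirectSum.
Context (k : nat) (m : 'I_k.+1 -> nat) (a : forall i, 'S_(m i)).

Lemma Rank0_val (j : 'I_(m ord0)) : tagnat.Rank ord0 j = j :> nat.
Proof. by rewrite tagnat.RankEsum big_pred0. Qed.

Lemma inflation1_Rank0 (j : 'I_(m ord0)) :
  inflation 1%g a (tagnat.Rank ord0 j) = a ord0 j :> nat.
Proof. by rewrite inflation_Rank big_pred0 // => i; rewrite !perm1. Qed.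

(** Entries outside the first block exceed all those in it, so a cut no later than its end only
    tests [a ord0]. *)
Lemma sum_cut_inflation1 d : d <= m ord0 ->
  sum_cut (inflation 1%g a) d = sum_cut (a ord0) d.
Proof.
move=> le_dm; apply/sum_cutP/sum_cutP => cut x y /andP[xd dy].
  by rewrite -!inflation1_Rank0; apply: cut; rewrite !Rank0_val xd.
have RankE (z : 'I_(\sum_i m i)) (lt_zm : z < m ord0) :
    z = tagnat.Rank ord0 (Ordinal lt_zm).
  by apply: ord_inj; rewrite Rank0_val.
have xm := leq_trans xd le_dm; case: (ltnP y (m ord0)) => ym.
  by rewrite (RankE x xm) (RankE y ym) !inflation1_Rank0; apply: cut; rewrite /= xd.
have y_neq0 : tagnat.sig1 y != ord0.
  apply: contraTneq ym => y0; rewrite -ltnNge -(tagnat.sig2K y).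
  by move: (tagnat.sig2 y); rewrite y0 => j; rewrite Rank0_val.
have x0 : tagnat.sig1 x = ord0 by rewrite (RankE x xm) tagnat.Rank1K.
rewrite inflation_order_quotient x0 1?eq_sym // !perm1 lt0n.
by apply: contraNneq y_neq0 => y0; apply/eqP/ord_inj.
Qed.

End DirectSum.

(** Cutting at the first possible place singles out the form 12[a, b] with a sum-indecomposable. *)
Definition first_cut n (p : 'S_n) (c : nat) : bool :=
  [&& 0 < c, sum_cut p c & [forall d : 'I_n, (0 < d < c) ==> ~~ sum_cut p d]].

Lemma first_cut_inflation1 n k (m : 'I_k.+1 -> nat) (a : forall i, 'S_(m i))
    (e : \sum_i m i = n) :
  0 < m ord0 ->
  first_cut (cast_perm e (inflation 1%g a)) (m ord0) = ~~ sum_decomposable (a ord0).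
Proof.
case: n / e => m_gt0; rewrite cast_perm_id /first_cut m_gt0 sum_cut_inflation1 //=.
have -> /= : sum_cut (a ord0) (m ord0).
  by apply/sum_cutP => x y /andP[_]; rewrite leqNgt ltn_ord.
apply/forallP/existsPn => H d.
  rewrite negb_and -implybE -(sum_cut_inflation1 a (ltnW (ltn_ord d))).
  by apply/implyP => d_gt0; have := H (tagnat.Rank ord0 d); rewrite Rank0_val d_gt0 ltn_ord.
apply/implyP => /andP[d_gt0 lt_dm]; have := H (Ordinal lt_dm).
by rewrite d_gt0 /= -(sum_cut_inflation1 a (ltnW lt_dm)).
Qed.

Definition sum_indecomposable n : pred 'S_n := fun p => ~~ sum_decomposable p.

Lemma first_cut_card n c : 0 < c < n ->
  #|[pred p : 'S_n | first_cut p c]| = #|@sum_indecomposable c| * (n - c)`!.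
Proof.
move=> /andP[c_gt0 lt_cn].
(* [1%g : 'S_2] is 12. The first block has size c and is sum-indecomposable, the second is
   arbitrary. *)
pose m (i : 'I_2) := if i == ord0 then c else n - c.
pose A i : pred 'S_(m i) := fun a => (i == ord0) ==> sum_indecomposable a.
transitivity #|[pred p : 'S_n | `[< inflated (pred1 1%g) A p >]]|.
  apply: eq_card => p; rewrite !inE; apply/idP/asboolP => [cut|].
    pose b (x : 'I_n) : 'I_2 := if x < c then ord0 else ord_max.
    have mono : order_quotient b 1%g 1%g.
      by move=> x y; rewrite !perm1 /b; case: (ltnP x c) => h; case: (ltnP y c) => h' //= _; lia.
    have cardb i : #|b @^-1: [set i]| = m i.
      have card0 : #|b @^-1: [set ord0]| = c.
        rewrite -[RHS](card_lt_ord (ltnW lt_cn)); apply: eq_card => x.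
        by rewrite !inE /b; case: ifP.
      case: (eqVneq i ord0) => [->|neq]; first by rewrite card0.
      rewrite /m (negbTE neq) -[n in RHS]card_ord -(cardC (b @^-1: [set ord0])) card0 addKn.
      have -> : i = ord_max.
        by apply: ord_inj; move: neq; rewrite -val_eqE /=; have := ltn_ord i; lia.
      by apply: eq_card => x; rewrite !inE /b; case: ifP.
    have quo : order_quotient b p 1%g.
      case/and3P: cut => _ /sum_cutP cut _ x y; rewrite !perm1 /b.
      case: (ltnP x c) => h; case: (ltnP y c) => h' //= _; first by rewrite cut ?h.
      by apply/negbTE; rewrite -leqNgt ltnW // cut ?h'.
    have [e [s [a [/eqP -> _ pE]]]] := inflated_of_blocks mono cardb quo.
    exists e, 1%g, a; split=> //= i; apply/implyP => /eqP ->.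
    by rewrite /sum_indecomposable -(first_cut_inflation1 a e) // -pE.
  case=> e [s [a [/eqP -> aA ->]]].
  by rewrite (first_cut_inflation1 a e) //; have := aA ord0.
rewrite card_inflated; last by rewrite big_ord_recl big_ord1 /= subnKC // ltnW.
  rewrite card1 mul1n big_ord_recl big_ord1; congr (_ * _).
  by rewrite -card_Sn; apply: eq_card.
by move=> i _ _; rewrite /m; case: ifP; rewrite // subn_gt0.
Qed.

(** A sum-decomposable permutation has exactly one first cut below n, any other permutation none. *)
Lemma sum_decomposable_card n : #|@sum_decomposable n| =
  \sum_(c < n | 0 < c) #|@sum_indecomposable c| * (n - c)`!.
Proof.
transitivity (\sum_(p : 'S_n) \sum_(c < n | 0 < c) first_cut p c).
  rewrite -sum1_card big_mkcond; apply: eq_bigr => p _; rewrite unfold_in.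
  case: ifP => [/existsP[c0 Pc0]|/negbT/existsPn ncut]; last first.
    rewrite big1 // => c c_gt0; have := ncut c; rewrite c_gt0 /= /first_cut.
    by move/negbTE => ->; rewrite andbF.
  case: (@arg_minnP _ c0 (fun c => (0 < c) && sum_cut p c) val Pc0).
  move=> c /andP[c_gt0 cut] c_min; rewrite (bigD1 c) //= big1 => [|d].
    rewrite addn0 /first_cut c_gt0 cut; case: forallP => // -[] d.
    apply/implyP => /andP[d_gt0 lt_dc]; apply/negP => dcut.
    by have := c_min d; rewrite d_gt0 dcut => /(_ isT); rewrite leqNgt lt_dc.
  case/andP=> d_gt0 neq; rewrite /first_cut d_gt0 /=.
  case: (boolP (sum_cut p d)) => //= dcut; case: forallP => // /(_ c).
  rewrite c_gt0 cut implybF /= ltn_neqAle eq_sym val_eqE neq /=.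
  by rewrite c_min // d_gt0.
rewrite exchange_big; apply: eq_bigr => c c_gt0.
have c_range : 0 < c < n by rewrite c_gt0 ltn_ord.
rewrite -(first_cut_card c_range) -sum1_card [RHS]big_mkcond.
by apply: eq_bigr => p _; rewrite inE; case: first_cut.
Qed.

(** * Functional equations and elimination of S *)

Local Open Scope ring_scope.

Local Notation S_series := (card_series long_simple).
Local Notation D_series := (card_series sum_decomposable).

Lemma W_series_eq : W_series = fpsX rat + fps_comp S_series W_series.
Proof.
have WE : W_series = card_series blockwise_simpleb.
  apply/fpsP => -[|n] //=; rewrite eq_card0 // => p.
  by apply/negP => /blockwise_simpleb_gt0.
rewrite [in RHS]WE -simple_inflation_series; last exact: blockwise_simpleb_gt0.
rewrite WE; apply/fpsP => n; rewrite fps_coefD /= -natrD; congr (_%:R).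
(* In degree 1 only the permutation 1 counts, since simple inflations have at least four entries. *)
case: (eqVneq n 1%N) => [->|n_neq1] /=.
  rewrite (_ : #|_| = 1`!); last first.
    by rewrite -card_Sn; apply: eq_card => p; apply/asboolP/blockwise_simpleP; left.
  rewrite eq_card0 // => p; apply/asboolP => /simple_inflation_size.
  by case/(_ blockwise_simpleb_gt0).
rewrite add0n; apply: eq_card => p; apply/asboolP/asboolP.
  by move/blockwise_simpleP => [n1|//]; rewrite n1 in n_neq1.
by move=> infl; apply/blockwise_simpleP; right.
Qed.

Lemma card_perm_trichotomy n : (if n is 0 then 0 else n`!)%N =
  ((n == 1) + #|[pred p : 'S_n | `[< simple_inflation nonempty p >]]|
    + #|@sum_decomposable n| + #|@skew_decomposable n|)%N.
Proof.
case: (ltnP 1 n) => [n_gt1|n_le1].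
  rewrite gtn_eqF // add0n; transitivity (\sum_(p : 'S_n) 1)%N.
    by rewrite sum1_card card_Sn; case: n n_gt1.
  under eq_bigr => p _ do rewrite -(perm_trichotomy p n_gt1).
  rewrite !big_split /= -!sum1_card !(big_mkcond (fun p => p \in _)) /=.
  by congr (_ + _ + _)%N; apply: eq_bigr => p _; rewrite unfold_in; case: ifP => ->.
rewrite skew_decomposable_card eq_card0 => [|p]; last first.
  apply/asboolP => /(simple_inflation_size (fun n p => id)).
  by rewrite ltnNge (leq_trans n_le1).
rewrite eq_card0 => [|p]; last first.
  apply/existsP => -[c /andP[c_gt0 _]]; have := ltn_ord c.
  by rewrite ltnNge (leq_trans n_le1).
by case: n n_le1 => [|[|]].
Qed.

Lemma F_series_eq :
  F_series = fpsX rat + fps_comp S_series F_series + D_series + D_series.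
Proof.
have FE : F_series = card_series nonempty.
  apply/fpsP => -[|n] /=; first by rewrite eq_card0.
  by rewrite -card_Sn; congr (_%:R); apply: eq_card.
rewrite [in RHS]FE -simple_inflation_series //; apply/fpsP => n.
rewrite !fps_coefD -!natrD -{2}skew_decomposable_card.
transitivity ((if n is 0 then 0 else n`!)%N%:R : rat); first by case: n.
by rewrite card_perm_trichotomy.
Qed.

(** F - D counts the sum-indecomposable permutations of positive length, so this is the splitting at
    the first cut. Solved for D, it reads F^2 / (1 + F). *)
Lemma D_series_eq : D_series = (F_series - D_series) * F_series.
Proof.
(* The term i = n drops out as F has no constant term. *)
apply/fpsP => n; rewrite fps_coefM big_ord_recr subnn /= mulr0 addr0.
rewrite sum_decomposable_card natr_sum big_mkcond; apply: eq_bigr => -[[|c] lt_cn] _ /=.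
  (* The cut c = 0 is excluded from the count, in accordance with F - D vanishing in degree 0. *)
  rewrite eq_card0 ?subrr ?mul0r // => p.
  by apply/existsP => -[[]].
rewrite natrM; congr (_ * _); last by rewrite -(subnSK lt_cn).
apply/eqP; rewrite eq_sym subr_eq -natrD -card_Sn; apply/eqP; congr (_%:R).
by rewrite -(cardC (@sum_decomposable c.+1)) addnC.
Qed.

Theorem mainTheorem7 :
  let t : {fps rat} := fpsX rat in
  compinv W_series = compinv F_series + 2%:R * t ^+ 2 / (1 + t).
Proof.
move=> t; set V := compinv W_series; set G := compinv F_series.
have [_ V0 WV _] := W_compinvP; have [_ G0 FG _] := F_compinvP.
have compD (f g h : {fps rat}) : fps_comp (f + g) h = fps_comp f h + fps_comp g h.
  apply/fpsP => n; rewrite fps_coefD /= -big_split.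
  by apply: eq_bigr => k _; rewrite mulrDl.
have compN (f h : {fps rat}) : fps_comp (- f) h = - fps_comp f h.
  apply/fpsP => n; rewrite fps_coefN /= -sumrN.
  by apply: eq_bigr => k _; rewrite mulNr.
(* The equations for W and F are evaluated at the inverses V and G. As W(V) = t and F(G) = t, the
   series S is taken at t both times. *)
have tV : t = V + S_series.
  by rewrite -[LHS]WV {1}W_series_eq compD -fps_compA // WV fps_compXf // fps_compfX.
have tG : t = G + S_series + fps_comp D_series G + fps_comp D_series G.
  by rewrite -[LHS]FG {1}F_series_eq !compD -fps_compA // FG fps_compXf // fps_compfX.
(* The same substitution in D = (F - D) F is linear in D(G), and is solved by inverting 1 + t. *)
have DG : fps_comp D_series G = (t - fps_comp D_series G) * t.
  by rewrite {1}D_series_eq fps_compM // compD compN FG.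
have {}DG : fps_comp D_series G = t ^+ 2 / (1 + t).
  apply: (canRL (mulrK fps_unit_1DX)).
  by rewrite -/t mulrDr mulr1 {1}DG mulrBl subrK expr2.
have -> : V = t - S_series by rewrite tV addrK.
rewrite {1}tG -mulrA -DG; ring.
Qed.
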